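(* Let $V$ be a real vector space of finite dimension, $A\subset V$ a conic domain and $\|\cdot\|:A\to\mathbb R$ a Minkowski conic pseudo-norm. Let $B=\{v\in A:\|v\|\le1\}$. Then: (a1) $B$ is a closed subset of $A$ which intersects all the directions $D_v:=\{\lambda v:\lambda>0\}$, $v\in A$. (a2) $B$ is starshaped from the origin, i.e. $v\in B$ implies $\lambda v\in B$ for all $\lambda\in(0,1)$. (a3) The boundary $S$ of $B$ in $A$ is a smooth hypersurface and a closed subset of $A$ such that the position vector at each $v\in S$ is transversal (not tangent) to $S$. (a4) For each $v\in B\setminus\{0\}$ there exists a (necessarily unique) $\lambda>0$ such that $v/\lambda\in S$.
   Context: Smooth means $C^\infty$. A conic domain $A\subset V$ is a non-empty open subset such that $v\in A$ implies $\lambda v\in A$ for all $\lambda>0$ (so $0\in A$ only if $A=V$). A Minkowski conic pseudo-norm is a map $\|\cdot\|:A\to\mathbb R$ such that $\|v\|\ge0$ for all $v\in A$ with equality iff $v=0$; $\|\lambda v\|=\lambda\|v\|$ for all $\lambda>0$ and $v\in A$; and $\|\cdot\|$ is smooth on $A\setminus\{0\}$. *)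

(* Defs.v *)
From HB Require Import structures.
From mathcomp Require Import all_boot all_order all_algebra.
From mathcomp Require Import all_classical all_reals all_analysis.

Set Implicit Arguments.
Unset Strict Implicit.
Unset Printing Implicit Defensive.
Import Order.TTheory GRing.Theory Num.Theory.
Import numFieldNormedType.Exports passmx.
Local Open Scope classical_set_scope.
Local Open Scope ring_scope.

(* [findim V] is the finite-dimensional real vector space [V] with its usual
   topology: a [vectType] carries no topology, so it is given the sup norm of the
   coordinates in a basis.  All norms on [V] being equivalent, none of the
   notions below depends on this choice. *)
Definition findim (R : realType) (V : vectType R) : Type := V.

Section FinDim.
Context (R : realType) (V : vectType R).

HB.instance Definition _ := Vector.on (findim V).

Definition findim_norm (v : findim V) : R := `|rVof (vbasis {:V}) v|.

Lemma findim_normD (x y : findim V) :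
  findim_norm (x + y) <= findim_norm x + findim_norm y.
Proof.
rewrite /findim_norm [rVof _ _](raddfD (rVof (vbasis {:V}))).
exact: ler_normD.
Qed.

Lemma findim_normZ (l : R) (x : findim V) :
  findim_norm (l *: x) = `|l| * findim_norm x.
Proof.
rewrite /findim_norm [rVof _ _](linearZZ (rVof (vbasis {:V}))).
exact: normrZ.
Qed.

Lemma findim_norm0_eq0 (x : findim V) : findim_norm x = 0 -> x = 0.
Proof.
move=> /normr0_eq0 x0.
by apply: (can_inj (rVofK (vbasisP {:V}))); rewrite x0 raddf0.
Qed.

HB.instance Definition _ := Lmodule_isNormed.Build R (findim V)
  findim_normD findim_normZ findim_norm0_eq0.

End FinDim.

(* [C^k] on an open set [U]; [f] is a total function, but only its values
   on [U] matter. *)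
Fixpoint class_C (R : realType) (V W : normedModType R) (k : nat) (U : set V)
    (f : V -> W) : Prop :=
  match k with
  | 0%N => forall x, U x -> {for x, continuous f}
  | k'.+1 => (forall x, U x -> differentiable f x) /\
             (forall v : V, class_C k' U ('D_v f))
  end.

Definition smooth_on (R : realType) (V W : normedModType R) (U : set V)
    (f : V -> W) : Prop :=
  forall k : nat, class_C k U f.

Definition is_diffeo (R : realType) (V W : normedModType R)
    (U : set V) (U' : set W) (phi : V -> W) (psi : W -> V) : Prop :=
  [/\ open U /\ open U',
      (forall x, U x -> U' (phi x)) /\ (forall y, U' y -> U (psi y)),
      (forall x, U x -> psi (phi x) = x) /\ (forall y, U' y -> phi (psi y) = y)
    & smooth_on U phi /\ smooth_on U' psi].

Definition conic_domain (R : realType) (V : vectType R)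
    (A : set (findim V)) : Prop :=
  [/\ A !=set0, open A &
      forall (v : findim V) (l : R), A v -> 0 < l -> A (l *: v)].

(* The map [A -> R] is represented by a total function, of which only the
   values on [A] are constrained. *)
Definition minkowski_conic_pseudo_norm (R : realType) (V : vectType R)
    (A : set (findim V)) (F : findim V -> R) : Prop :=
  [/\ forall v, A v -> 0 <= F v,
      forall v, A v -> (F v = 0 <-> v = 0),
      forall (l : R) v, A v -> 0 < l -> F (l *: v) = l * F v
    & smooth_on (A `\ 0) F].

Definition closed_unit_ball (R : realType) (V : vectType R)
    (A : set (findim V)) (F : findim V -> R) : set (findim V) :=
  [set v | A v /\ F v <= 1].

(* [subspace A] also contains the points outside [A], but as isolated points:
   for [B `<=` A] its open and closed sets, closures and interiors are those
   of the relative topology of [A]. *)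
Definition closed_in (T : topologicalType) (A B : set T) : Prop :=
  closed (B : set (subspace A)).

Definition boundary_in (T : topologicalType) (A B : set T) : set T :=
  closure (B : set (subspace A)) `\` interior (B : set (subspace A)).

Definition direction (R : realType) (V : vectType R) (v : findim V) :
    set (findim V) :=
  [set l *: v | l in [set l : R | 0 < l]].

(* Embedded hypersurface: around each of its points, a smooth diffeomorphism
   between open sets straightens [S] to a piece of a linear hyperplane [H]. *)
Definition smooth_hypersurface (R : realType) (V : vectType R)
    (S : set (findim V)) : Prop :=
  forall p, S p ->
    exists (U U' : set (findim V)) (phi psi : findim V -> findim V)
           (H : {vspace findim V}),
      [/\ U p, is_diffeo U U' phi psi,
          (\dim H).+1 = \dim {: findim V}
        & forall x, U x -> (S x <-> phi x \in H)].

(* Velocities at [p] of smooth curves lying on [S]. *)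
Definition tangent_at (R : realType) (V : vectType R) (S : set (findim V))
    (p u : findim V) : Prop :=
  exists (e : R) (c : R -> findim V),
    [/\ 0 < e, smooth_on [set t : R | `|t| < e] c,
        (forall t : R, `|t| < e -> S (c t)), c 0 = p & derive1 c 0 = u].

(* As [T_p S] has codimension 1, being transversal to a hypersurface means not
   being tangent to it. *)
Definition transversal_at (R : realType) (V : vectType R) (S : set (findim V))
    (p u : findim V) : Prop :=
  ~ tangent_at S p u.

(* Main.v *)
(* As [A] is open, continuity and homogeneity of [F] give [S = {F = 1}]; that
   [0] is interior to [B] when it lies in [A] needs the compactness of the unit
   sphere.  By Euler's relation [dF_v (v) = F v = 1] on [S], whereas [dF_v] kills
   the velocities of curves lying on [S].  Homogeneity also makes the inverse
   function theorem unnecessary: if [l] is a linear form with [l p = 1], then on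
   the half of [A] where [l > 0] the map [v |-> (F v - 1) p + v / l v - p]
   straightens [S] to [ker l], with an explicit smooth inverse. *)
From HB Require Import structures.
Require Import Defs.
From mathcomp Require Import all_boot all_order all_algebra.
From mathcomp Require Import all_classical all_reals all_analysis.
Set Implicit Arguments.
Unset Strict Implicit.
Unset Printing Implicit Defensive.
Import Order.TTheory GRing.Theory Num.Theory.
Import numFieldNormedType.Exports passmx.
Local Open Scope classical_set_scope.
Local Open Scope ring_scope.

(** * Differentials: locality, product rule for scaling, chain rule *)

Lemma near_eq_differentiable (R : numFieldType) (V W : normedModType R)
    (f g : V -> W) (x : V) :
  (\near x, f x = g x) -> differentiable f x -> differentiable g x.
Proof.
move=> fg df; have fgx : f x = g x by exact: nbhs_singleton fg.
have gE : g \o shift x = cst (g x) + 'd f x +o_ 0 id.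
  apply/eqaddoP => _ /posnumP[e].
  have /eqaddoP/(_ e%:num (gt0 e)) fE := diff_locally df.
  move: fg; rewrite (near_shift 0) subr0 => fg.
  near=> h; have fgh : f (h + x) = g (h + x) by near: h.
  have : `|f (h + x) - (f x + 'd f x h)| <= e%:num * `|h| by near: h.
  by rewrite fgh fgx.
(* ['d g x] is a chosen linear map; the first-order expansion [gE] pins it down, since only one
   continuous linear map can satisfy it. *)
have dg : 'd g x = 'd f x :> (V -> W).
  by apply: diff_unique => //; exact: diff_continuous.
by apply/diff_locallyP; rewrite dg; split => //; exact: diff_continuous.
Unshelve. all: by end_near. Qed.

Section ScaleDerivative.
Context (R : numFieldType) (V W : normedModType R).

(** Once scaling is registered as bilinear, the product rule for a scalar function times a
    vector-valued one is the differential of a continuous bilinear map composed with a pair. *)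
Lemma scale_is_bilinear :
  bilinear_for
    (GRing.Scale.Law.clone _ _ *:%R _) (GRing.Scale.Law.clone _ _ *:%R _)
    (@GRing.scale R W : R -> W -> W).
Proof.
split=> [w|r] a x y /=; first by rewrite scalerDl scalerA.
by rewrite scalerDr !scalerA mulrC.
Qed.

HB.instance Definition _ := bilinear_isBilinear.Build R R W W _ _
  (@GRing.scale R W : R -> W -> W) scale_is_bilinear.

Lemma is_diff_scale (p : R * W) :
  is_diff p (fun q => q.1 *: q.2) (fun q => p.1 *: q.2 + q.1 *: p.2).
Proof.
apply: DiffDef; last by rewrite diff_bilin // => ?; apply: scale_continuous.
by apply: differentiable_bilin => ?; apply: scale_continuous.
Qed.

Lemma is_diff_scale_fun (g dg : V -> R) (f df : V -> W) (x : V) :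
  is_diff x g dg -> is_diff x f df ->
  is_diff x (fun y => g y *: f y) (fun y => g x *: df y + dg y *: f x).
Proof.
move=> dgx dfx; have dpx := is_diff_pair dgx dfx.
exact: (is_diff_comp dpx (is_diff_scale (g x, f x))).
Qed.

Lemma differentiable_scale (g : V -> R) (f : V -> W) (x : V) :
  differentiable g x -> differentiable f x ->
  differentiable (fun y => g y *: f y) x.
Proof.
move=> /differentiableP dg /differentiableP df.
by have [] := is_diff_scale_fun dg df.
Qed.

Lemma derive_scale (g : V -> R) (f : V -> W) (x v : V) :
  differentiable g x -> differentiable f x ->
  'D_v (fun y => g y *: f y) x = g x *: 'D_v f x + 'D_v g x *: f x.
Proof.
move=> dgx dfx; rewrite deriveE; last exact: differentiable_scale.
move/differentiableP: (dgx) => dg; move/differentiableP: (dfx) => df.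
by have [_ ->] := is_diff_scale_fun dg df; rewrite !deriveE.
Qed.

End ScaleDerivative.

Lemma derive_comp (R : numFieldType) (U V W : normedModType R)
    (f : U -> V) (g : V -> W) (x v : U) :
  differentiable f x -> differentiable g (f x) ->
  'D_v (g \o f) x = 'D_('D_v f x) g (f x).
Proof.
move=> df dg; rewrite [LHS]deriveE; last exact: differentiable_comp.
rewrite (congr1 (fun h : U -> W => h v) (diff_comp df dg)) /=.
by rewrite -(deriveE _ df) -(deriveE _ dg).
Qed.

(** * Stability properties of maps of class [C^k] *)

Section ClassC.
Context (R : realType).
Implicit Types V W : normedModType R.

(** On an open set, equality on [U] is equality near each point of [U], so it passes to directional
    derivatives. The inductions below use this to replace ['D_v f] by a formula valid on [U]
    only. *)
Lemma class_C_ext V W (k : nat) (U : set V) (f g : V -> W) :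
  open U -> (forall x, U x -> f x = g x) -> class_C k U f -> class_C k U g.
Proof.
move=> oU; elim: k f g => [|k IH] f g fg /=.
  move=> cf x Ux; have fgx : \near x, f x = g x.
    by apply: filterS fg _; exact: open_nbhs_nbhs.
  rewrite /prop_for /continuous_at -fg //.
  exact: cvg_trans (near_eq_cvg fgx) (cf x Ux).
have near_fg x : U x -> \near x, f x = g x.
  by move=> Ux; apply: filterS fg _; exact: open_nbhs_nbhs.
move=> [df Df]; split=> [x Ux|v].
  exact: near_eq_differentiable (near_fg _ Ux) (df _ Ux).
by apply: IH (Df v) => x Ux; exact/near_eq_derive/near_fg.
Qed.

Lemma class_C_sub V W (k : nat) (U U' : set V) (f : V -> W) :
  U `<=` U' -> class_C k U' f -> class_C k U f.
Proof.
move=> UU'; elim: k f => [|k IH] f /=; first by move=> cf x /UU'; exact: cf.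
by move=> [df Df]; split=> [x /UU'|v]; [exact: df|exact/IH/Df].
Qed.

Lemma class_CW V W (k : nat) (U : set V) (f : V -> W) :
  class_C k.+1 U f -> class_C k U f.
Proof.
elim: k f => [|k IH] f.
  by move=> [df _] x Ux; exact/differentiable_continuous/df.
by move=> [df Df]; split=> // v; exact/IH/Df.
Qed.

Lemma class_C_cst V W (k : nat) (U : set V) (a : W) : class_C k U (cst a).
Proof.
elim: k a => [|k IH] a /=; first by move=> x _; exact: cst_continuous.
split=> [x _|v]; first exact: differentiable_cst.
by rewrite (_ : 'D_v _ = cst 0) //; apply/funext => x; rewrite derive_cst.
Qed.

Lemma class_C_linear V W (k : nat) (U : set V) (f : {linear V -> W}) :
  continuous f -> class_C k U f.
Proof.
move=> cf; have df x : differentiable f x by exact: linear_differentiable.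
case: k => [|k]; first by move=> x _; exact: cf.
split=> // v; rewrite (_ : 'D_v f = cst (f v)); first exact: class_C_cst.
by apply/funext => x; rewrite deriveE // diff_lin.
Qed.

Lemma class_CD V W (k : nat) (U : set V) (f g : V -> W) :
  open U -> class_C k U f -> class_C k U g -> class_C k U (f + g).
Proof.
move=> oU; elim: k f g => [|k IH] f g /=.
  by move=> cf cg x Ux; apply: continuousD; [exact: cf|exact: cg].
move=> [df Df] [dg Dg]; split=> [x Ux|v].
  by apply: differentiableD; [exact: df|exact: dg].
apply: (class_C_ext oU) (IH _ _ (Df v) (Dg v)) => x Ux.
by rewrite deriveD //; apply: diff_derivable; [exact: df|exact: dg].
Qed.

Lemma class_C_scale V W (k : nat) (U : set V) (g : V -> R) (f : V -> W) :
  open U -> class_C k U g -> class_C k U f ->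
  class_C k U (fun x => g x *: f x).
Proof.
move=> oU; elim: k f g => [|k IH] f g.
  by move=> cg cf x Ux; apply: cvgZ; [exact: cg|exact: cf].
move=> Cg Cf; have [dg Dg] := Cg; have [df Df] := Cf.
split=> [x Ux|v]; first by apply: differentiable_scale; [exact: dg|exact: df].
(* Each term of the product rule pairs a derivative, of class [C^k], with an undifferentiated
   factor, which [class_CW] lowers to the same order. *)
apply: (class_C_ext oU) (class_CD oU (IH _ _ (class_CW Cg) (Df v))
  (IH _ _ (Dg v) (class_CW Cf))) => x Ux.
by rewrite derive_scale; [|exact: dg|exact: df].
Qed.

(** The derivative of [1/g] is [-(1/g)(1/g)] times that of [g], a product of maps already known to
    be of class [C^k], so the induction closes. *)
Lemma class_C_inv V (k : nat) (U : set V) (g : V -> R) :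
  open U -> (forall x, U x -> g x != 0) -> class_C k U g ->
  class_C k U (fun x => (g x)^-1).
Proof.
move=> oU g0; elim: k => [|k IH].
  by move=> cg x Ux; apply: cvgV; [exact: g0|exact: cg].
move=> Cg; have [dg Dg] := Cg.
split=> [x Ux|v]; first by apply: differentiableV; [exact: dg|exact: g0].
have Cgi := IH (class_CW Cg).
apply: (class_C_ext oU) (class_C_scale oU (class_C_cst k U (-1 : R))
  (class_C_scale oU (class_C_scale oU Cgi Cgi) (Dg v))) => x Ux.
rewrite deriveV; [|exact: g0|exact/diff_derivable/dg].
by rewrite scaleN1r -scaleNr expr2 invfM.
Qed.

(** For an affine inner map the direction [M v] in the chain rule does not depend on the point: the
    derivative of the composite is ['D_(M v) f] composed with the same affine map, and the induction
    applies to it. *)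
Lemma class_C_comp_affine V' V W (k : nat) (U : set V) (f : V -> W)
    (M : {linear V' -> V}) (a : V) :
  continuous M -> open U -> class_C k U f ->
  class_C k ((fun x => M x + a) @^-1` U) (fun x => f (M x + a)).
Proof.
pose L := (M : V' -> V) + cst a.
rewrite -[fun x => M x + a]/L -[fun x => f _]/(f \o L) => cM oU.
have dM x : differentiable M x by exact: linear_differentiable.
have dL x : differentiable L x by exact: differentiableD.
have DL v x : 'D_v L x = M v.
  rewrite deriveD ?derive_cst ?addr0; [|exact: diff_derivable..].
  by rewrite deriveE // diff_lin.
have oLU : open (L @^-1` U).
  by apply: open_comp oU => x _; exact/differentiable_continuous.
elim: k f => [|k IH] f /=.
  move=> cf x Ux; apply: continuous_comp; last exact: cf.
  exact/differentiable_continuous.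
move=> [df Df]; split=> [x Ux|v]; first exact: differentiable_comp (df _ Ux).
apply: (class_C_ext oLU) (IH _ (Df (M v))) => x Ux /=.
by rewrite [RHS]derive_comp ?DL //; exact: df.
Qed.

End ClassC.

(** * Topology of [findim V], linear forms, relative neighbourhoods *)

Lemma isometry_continuous (R : numFieldType) (V W : normedModType R)
    (f : V -> W) :
  (forall u v, `|f u - f v| = `|u - v|) -> continuous f.
Proof.
move=> fI v; apply/cvgrPdist_lt => e e0; apply: filterS (nbhsx_ballx v _ e0) => u.
by rewrite -ball_normE /= fI.
Qed.

Section FindimTopology.
Context (R : realType) (V : vectType R).
Implicit Types v p : findim V.

Local Notation rV := 'rV[R]_(\dim {:V}).
Local Notation toV := (vecof (vbasis {:V}) : rV -> findim V).
Local Notation ofV := (rVof (vbasis {:V}) : findim V -> rV).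

(** The norm is by definition that of the coordinates, so the coordinate maps are isometries;
    compactness and continuity are carried over from row vectors through them. *)
Lemma norm_vecof (x : rV) : `|toV x| = `|x|.
Proof. by rewrite -[LHS]/(`|ofV (toV x)|) vecofK // vbasisP. Qed.

Lemma vecof_continuous : continuous toV.
Proof.
apply: (@isometry_continuous R rV (findim V)) => x y.
by rewrite -[RHS]norm_vecof linearB.
Qed.

Lemma rVof_continuous : continuous ofV.
Proof.
apply: (@isometry_continuous R (findim V) rV) => u v.
by rewrite -[RHS]/(`|ofV (u - v)|) (raddfB (rVof (vbasis {:V}))).
Qed.

Lemma compact_findim_sphere : compact [set v : findim V | `|v| = 1].
Proof.
rewrite (_ : mkset _ = toV @` [set x : rV | `|x| = 1]); last first.
  apply/seteqP; split=> v /=; last by move=> [x x1 <-]; rewrite norm_vecof.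
  by move=> v1; exists (ofV v) => //; rewrite rVofK // vbasisP.
apply: continuous_compact; first exact/continuous_subspaceT/vecof_continuous.
apply: bounded_closed_compact.
  by exists 1; split=> // r r1 x /= ->; exact: ltW.
apply: (@preimage_closed _ _ (fun x : rV => `|x|) [set 1]).
  by move=> x _; exact: norm_continuous.
exact: closed_eq.
Qed.

(** Some coordinate of [p] is nonzero; divide that coordinate function by its value at [p]. *)
Lemma exists_linear_form p : p != 0 ->
  exists2 l : {linear findim V -> R}, continuous l & l p = 1.
Proof.
move=> p0; have /rV0Pn[i pi0] : ofV p != 0 by rewrite rVof_eq0 // vbasisP.
pose f v : R := (ofV p 0 i)^-1 * ofV v 0 i.
have lf : linear f.
  by move=> a u v; rewrite /f linearP !mxE mulrDr mulrCA.
pose fM := GRing.isLinear.Build _ _ _ _ f lf.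
pose l : {linear findim V -> R} := HB.pack f fM.
exists l; last by rewrite -[LHS]/(f p) /f mulVf.
move=> v; apply: (@continuousM _ _ (cst _) (fun u => ofV u 0 i)).
  exact: cst_continuous.
exact: (continuous_comp (@rVof_continuous v) (@coord_continuous _ _ _ 0 i _)).
Qed.

(** Rank-nullity: [l] is onto because [r *: p] is sent to [r]. *)
Lemma dim_lker_linear_form (l : {linear findim V -> R}) p : l p = 1 ->
  (\dim (lker (linfun (l : findim V -> R^o)))).+1 = \dim {: findim V}.
Proof.
move=> lp; set f := linfun _.
have fE v : f v = l v by rewrite lfunE.
rewrite -(limg_ker_dim f {: findim V}) capfv -addn1; congr addn.
suff -> : limg f = fullv by rewrite dimvf.
apply/eqP; rewrite eqEsubv subvf; apply/subvP => r _.
have <- : f (r *: p) = r by rewrite fE linearZ /= lp [LHS]mulr1.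
exact/memv_img/memvf.
Qed.

End FindimTopology.

(** At a point of [A], the neighbourhoods in [subspace A] are the traces of the ambient ones; this
    turns relative closures and interiors into statements about nearby points of [A]. *)
Lemma near_subspace (T : topologicalType) (A P : set T) (x : T) : A x ->
  nbhs (x : subspace A) P <-> \forall y \near x, A y -> P y.
Proof.
move=> Ax; change (nbhs_subspace (x : subspace A) P <-> within A (nbhs x) P).
by rewrite nbhs_subspace_in.
Qed.

(** * Unit ball of a conic pseudo-norm and its relative boundary *)

Section ConicPseudoNorm.
Context (R : realType) (V : vectType R) (A : set (findim V))
  (F : findim V -> R).
Hypotheses (conicA : conic_domain A)
  (normF : minkowski_conic_pseudo_norm A F).
Implicit Types (u v p : findim V) (l : R).

Local Notation B := (closed_unit_ball A F).
Local Notation S := (boundary_in A B).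

Let openA : open A. Proof. by case: conicA. Qed.

Let coneA v l : A v -> 0 < l -> A (l *: v).
Proof. by case: conicA => _ _; exact. Qed.

Lemma pseudo_norm_gt0 v : A v -> v != 0 -> 0 < F v.
Proof.
have [F_ge0 F0 _ _] := normF; move=> Av v0; rewrite lt_neqAle F_ge0 // andbT.
by rewrite eq_sym; apply/eqP => /(F0 _ Av)/eqP; rewrite (negPf v0).
Qed.

Lemma pseudo_norm_neq0 v : A v -> F v != 0 -> v != 0.
Proof.
by have [_ F0 _ _] := normF; move=> Av; apply: contraNN => /eqP /(F0 _ Av)/eqP.
Qed.

Lemma pseudo_norm_scale v l : A v -> 0 < l -> F (l *: v) = l * F v.
Proof. by case: normF => _ _ + _; exact. Qed.

Lemma pseudo_norm_differentiable v : A v -> v != 0 -> differentiable F v.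
Proof.
case: normF => _ _ _ /(_ 1)[dF _] Av v0.
by apply: dF; split=> //= vE; rewrite vE eqxx in v0.
Qed.

Lemma pseudo_norm_continuous v : A v -> v != 0 -> {for v, continuous F}.
Proof.
by move=> Av v0; exact/differentiable_continuous/pseudo_norm_differentiable.
Qed.

Lemma conic_domain0 : A 0 -> forall v, A v.
Proof.
move=> A0 v; have [->//|v0] := eqVneq v 0.
have /nbhs_normP[e /= e0 eA] : nbhs (0 : findim V) A by exact: open_nbhs_nbhs.
(* [t *: v] has norm [e / 2], so it lies in the ball around [0] contained in [A]; scaling back by
   [t^-1] stays in the cone. *)
pose t := e / 2 / `|v|.
have t0 : 0 < t by rewrite !divr_gt0 // normr_gt0.
rewrite -[v](scalerK (lt0r_neq0 t0)); apply: coneA; last by rewrite invr_gt0.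
apply: eA; rewrite /= sub0r normrN normrZ gtr0_norm // divfK ?normr_eq0 //.
by rewrite ltr_pdivrMr // ltr_pMr // ltr1n.
Qed.

(* [F] need not be smooth at [0]: it is bounded on the compact unit sphere,
   hence [F v] is at most a multiple of [`|v|]. *)
Lemma pseudo_norm_near0 : A 0 -> \forall v \near (0 : findim V), F v < 1.
Proof.
move=> /conic_domain0 AT.
have cF : {within [set v : findim V | `|v| = 1], continuous F}.
  apply: continuous_in_subspaceT => v /set_mem /= v1.
  by apply: pseudo_norm_continuous (AT v) _; rewrite -normr_eq0 v1 oner_eq0.
have cS := @compact_findim_sphere R V.
have [M [_ FM]] := compact_bounded (continuous_compact cF cS).
(* [FM] bounds [F] on the sphere by any number above [M], and [M] may be negative; [m] is above [M]
   and positive, so [m^-1] can serve as a radius. *)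
pose m := `|M| + 1; have m0 : 0 < m by rewrite ltr_wpDl.
have Fm v : `|v| = 1 -> F v <= m.
  move=> v1; apply: le_trans (ler_norm _) (FM m _ (F v) _); last by exists v.
  by rewrite (le_lt_trans (ler_norm _)) // ltrDl.
have mV0 : 0 < m^-1 by rewrite invr_gt0.
apply: filterS (nbhsx_ballx (0 : findim V) _ mV0) => v.
rewrite -ball_normE /= sub0r normrN => vm.
have [->|v0] := eqVneq v 0.
  by have [_ F0 _ _] := normF; have [_ ->] := F0 _ (AT 0).
have nv0 : 0 < `|v| by rewrite normr_gt0.
rewrite -[v](scalerKV (lt0r_neq0 nv0)) pseudo_norm_scale //.
apply: le_lt_trans (_ : `|v| * m < 1); last by rewrite -ltr_pdivlMr // div1r.
rewrite ler_pM2l //; apply: Fm.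
by rewrite normrZ gtr0_norm ?invr_gt0 // mulVf // lt0r_neq0.
Qed.

Lemma pseudo_norm_lt1_near v :
  A v -> F v < 1 -> \forall u \near v, F u < 1.
Proof.
move=> Av Fv1; have [v0|v0] := eqVneq v 0.
  by rewrite v0; apply: pseudo_norm_near0; rewrite -v0.
exact: (cvgr_lt _ (pseudo_norm_continuous Av v0) _ Fv1).
Qed.

Lemma pseudo_norm_gt1_near v :
  A v -> 1 < F v -> \forall u \near v, 1 < F u.
Proof.
move=> Av Fv1; have v0 : v != 0.
  by apply: pseudo_norm_neq0 => //; rewrite gt_eqF // (lt_trans ltr01).
exact: (cvgr_gt _ (pseudo_norm_continuous Av v0) _ Fv1).
Qed.

Lemma closed_in_unit_ball : closed_in A B.
Proof.
move=> v clBv; have [Av|nAv] := pselect (A v).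
  split=> //; rewrite leNgt; apply/negP => Fv1.
  have /clBv[u [[Au Fu1] /(_ Au)]] :
      nbhs (v : subspace A) [set u | A u -> 1 < F u].
    apply/near_subspace => //.
    by apply: filterS (pseudo_norm_gt1_near Av Fv1) => u Fu1 _.
  by rewrite ltNge Fu1.
(* A point outside [A] is isolated in [subspace A], so its singleton is a neighbourhood and must
   meet [B]. *)
have /clBv[u [Bu /= <- //]] : nbhs (v : subspace A) [set v].
by change (nbhs_subspace (v : subspace A) [set v]); rewrite -nbhs_subspace_out.
Qed.

Lemma boundary_unit_ballE : S = [set v | A v /\ F v = 1].
Proof.
apply/seteqP; split=> v.
  move=> [/closed_in_unit_ball[Av Fv1] Bv]; split=> //; apply/eqP.
  rewrite eq_le Fv1 leNgt; apply/negP => Fv_lt1; apply: Bv.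
  apply/near_subspace => //.
  apply: filterS (pseudo_norm_lt1_near Av Fv_lt1) => u Fu1 Au.
  by split=> //; exact: ltW.
move=> [Av Fv1]; split; first by apply: subset_closure; split; rewrite ?Fv1.
move=> /(near_subspace _ Av) /nbhs_normP[e /= e0 eB].
have v0 : v != 0 by apply: pseudo_norm_neq0; rewrite ?Fv1 ?oner_eq0.
(* [v] is not interior: [(1 + t) *: v] is at distance [e / 2] from it, and [F] takes the value
   [1 + t] there. *)
pose t := e / 2 / `|v|.
have t0 : 0 < t by rewrite !divr_gt0 // normr_gt0.
have t1 : 0 < 1 + t by rewrite addr_gt0.
have Atv : A ((1 + t) *: v) by exact: coneA.
have /eB/(_ Atv)[_] : `|v - (1 + t) *: v| < e.
  rewrite scalerDl scale1r opprD addNKr normrN normrZ gtr0_norm //.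
  by rewrite divfK ?normr_eq0 // ltr_pdivrMr // ltr_pMr // ltr1n.
by rewrite pseudo_norm_scale // Fv1 mulr1 gerDl leNgt t0.
Qed.

(** Differentiate [F (t *: v)] at [t = 1] in two ways: by the chain rule, and as [t * F v], which it
    equals for [t > 0], hence near [1]. *)
Lemma pseudo_norm_euler v : A v -> v != 0 -> 'D_v F v = F v.
Proof.
move=> Av v0; pose c (t : R) := t *: v.
have [did _] := is_diff_id (1 : R).
have dc : differentiable c (1 : R).
  by apply: differentiable_scale did _; exact: differentiable_cst.
have Dc : 'D_1 c 1 = v.
  rewrite [LHS](derive_scale (1 : R) did (differentiable_cst v _)).
  by rewrite derive_id derive_cst scaler0 add0r scale1r.
have c1 : c 1 = v by rewrite /c scale1r.
have := derive_comp (1 : R) dc; rewrite Dc c1.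
move=> /(_ _ F (pseudo_norm_differentiable Av v0)) <-.
rewrite -(@near_eq_derive _ _ _ (fun t : R => t * F v)).
  rewrite [LHS](derive_scale (1 : R) did (differentiable_cst (F v) _)).
  by rewrite derive_id derive_cst scaler0 add0r [LHS]mul1r.
near=> t; rewrite /= /c pseudo_norm_scale //; near: t.
exact: lt_nbhsr.
Unshelve. all: by end_near. Qed.

Lemma transversal_unit_sphere v : S v -> transversal_at S v v.
Proof.
rewrite boundary_unit_ballE => -[Av Fv1] [e [c [e0 /(_ 1%N)[dc _] cS c0 Dc]]].
have v0 : v != 0 by apply: pseudo_norm_neq0; rewrite ?Fv1 ?oner_eq0.
have dc0 : differentiable c (0 : R) by apply: dc; rewrite /= normr0.
have dF : differentiable F (c 0) by rewrite c0; exact: pseudo_norm_differentiable.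
have := derive_comp (1 : R) dc0 dF; rewrite -(derive1E c) Dc c0 pseudo_norm_euler // Fv1.
(* [F] is constantly [1] along [c] for [|t| < e], so the derivative just computed to be [1] is also
   [0]. *)
rewrite -(@near_eq_derive R R R (cst 1)) ?derive_cst.
  by move=> /esym/eqP; rewrite oner_eq0.
apply: filterS (nbhsx_ballx (0 : R) _ e0) => t; rewrite -ball_normE /= sub0r normrN.
by move=> /cS[].
Qed.

Lemma smooth_hypersurface_unit_sphere : smooth_hypersurface S.
Proof.
rewrite boundary_unit_ballE => p [Ap Fp1].
have p0 : p != 0 by apply: pseudo_norm_neq0; rewrite ?Fp1 ?oner_eq0.
have [l cl lp] := exists_linear_form p0.
have [_ _ _ smoothF] := normF.
pose U := A `&` [set v | 0 < l v].
have oU : open U.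
  apply: openI => //.
  by apply: (@open_comp _ _ l [set r : R | 0 < r]) => [v _|]; [exact: cl|exact: open_gt].
have UA0 : U `<=` A `\ 0.
  by move=> v [Av lv]; split=> // v0; move: lv; rewrite /= v0 linear0 ltxx.
have F_gt0 v : U v -> 0 < F v.
  by move=> /UA0[Av v0]; apply: pseudo_norm_gt0 => //; exact/eqP.
have CF k : class_C k U F by apply: class_C_sub UA0 _; exact: smoothF.
have Cl k W : class_C k W l by exact: class_C_linear.
(* [L] is the projection along [p] onto the hyperplane [l = 1]. *)
pose M v := v - l v *: p.
have linM : linear M.
  move=> r u v; rewrite /M linearP scalerBr [_ *: p]scalerDl opprD scalerA.
  by rewrite addrACA.
pose ML : {linear findim V -> findim V} :=
  HB.pack M (GRing.isLinear.Build _ _ _ _ M linM).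
have cM : continuous ML.
  move=> v; apply: (@continuousB _ _ _ id (fun u => l u *: p)); first exact: cvg_id.
  exact: continuous_comp (cl v) (@scalel_continuous _ _ p (l v)).
pose L v := ML v + p.
have lL v : l (L v) = 1.
  by rewrite /L /= /M linearD linearB linearZ /= lp [_ *: _]mulr1 subrr add0r.
have oLA : open (L @^-1` A).
  apply: open_comp => // v _; apply: continuousD; first exact: cM.
  exact: cst_continuous.
have AL v : A (L v) -> U (L v) by move=> ALv; split; rewrite //= lL.
(* [U'] is the image of [U]: [phi v] has [l]-value [F v - 1 > -1], and its projection by [L] is
   [v / l v], which lies in the cone [A]. *)
pose U' := [set v | 0 < l v + 1] `&` L @^-1` A.
have U'UL : U' `<=` L @^-1` U by move=> v [_ /AL].
(* Sums of functions and explicit [cst] let the [class_C] lemmas apply directly. *)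
pose phi := (fun v => (F v + cst (-1) v) *: p) + (fun v => (l v)^-1 *: v) +
  cst (- p).
(* If [w = phi v], then [L w] gives the ray of [v] and [l w + 1] is [F v]; so [v] is [L w] rescaled
   to have [F]-value [l w + 1]. *)
pose psi v := (l v + cst 1 v) *: ((F (L v))^-1 *: L v).
exists U, U', phi, psi, (lker (linfun (l : findim V -> R^o))).
have lphi v : U v -> l (phi v) = F v - 1.
  move=> [_ lv]; rewrite -[phi v]/((F v - 1) *: p + (l v)^-1 *: v - p).
  rewrite linearB linearD !linearZ /= lp [_ *: 1]mulr1 [_ *: l v]mulVf ?gt_eqF //.
  by rewrite addrK.
have lpsi v : l (psi v) = (l v + 1) / F (L v).
  by rewrite /psi !linearZ /= lL [_ *: 1]mulr1.
have Lphi v : U v -> L (phi v) = (l v)^-1 *: v.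
  move=> Uv; rewrite /L /= /M lphi //.
  rewrite -[phi v]/((F v - 1) *: p + (l v)^-1 *: v - p).
  by rewrite addrAC subrK [X in X - _]addrC addrK.
have Fpsi v : U' v -> F (psi v) = l v + 1.
  move=> [lv ALv]; have FLv := F_gt0 _ (AL _ ALv).
  rewrite !pseudo_norm_scale ?invr_gt0 // ?mulVf ?mulr1 ?gt_eqF //.
  by apply: coneA; rewrite ?invr_gt0.
have oU' : open U'.
  apply: openI => //.
  apply: (@open_comp _ _ (fun v => l v + 1) [set r : R | 0 < r]) => [v _|].
    apply: (@continuousD _ _ _ l (cst 1)); first exact: cl.
    exact: cst_continuous.
  exact: open_gt.
split; first by split=> //=; rewrite lp.
- split.
  + by [].
  + split=> v.
      move=> Uv; have [Av lv] := Uv; split=> /=.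
        by rewrite lphi // subrK F_gt0.
      by rewrite Lphi //; apply: coneA; rewrite // invr_gt0.
    move=> U'v; have [lv ALv] := U'v; have FLv := F_gt0 _ (AL _ ALv).
    split; last by rewrite /= lpsi // divr_gt0.
    by apply: coneA; [apply: coneA; rewrite // invr_gt0|].
  + split=> v.
      move=> Uv; have [Av lv] := Uv; have Fv := F_gt0 _ Uv.
      rewrite /psi lphi // Lphi // pseudo_norm_scale ?invr_gt0 // subrK.
      rewrite !scalerA invfM invrK mulrAC divff ?gt_eqF // mul1r.
      by rewrite divff ?gt_eqF // scale1r.
    move=> U'v; have [lv ALv] := U'v; have FLv := F_gt0 _ (AL _ ALv).
    rewrite /phi /= -[LHS]/((F (psi v) - 1) *: p + (l (psi v))^-1 *: psi v - p).
    rewrite Fpsi // lpsi addrK /psi (scalerA (l v + 1)) scalerA.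
    rewrite mulVf ?gt_eqF ?divr_gt0 // scale1r.
    by rewrite /L /= /M addrA addrK addrC subrK.
  + split=> k.
      apply: class_CD (class_C_cst _ _ _) => //; apply: class_CD => //; last first.
        apply: class_C_scale => //; last first.
          by apply: (@class_C_linear _ _ _ _ _ idfun) => v; exact: cvg_id.
        by apply: class_C_inv => // v [_ /lt0r_neq0].
      apply: class_C_scale (class_C_cst _ _ _) => //.
      by apply: class_CD (class_C_cst _ _ _).
    apply: class_C_scale => //; first by apply: class_CD (class_C_cst _ _ _).
    apply: class_C_scale => //; last first.
      by apply: class_CD (class_C_cst _ _ _) => //; exact: class_C_linear.
    apply: class_C_inv => // [v /U'UL/F_gt0/lt0r_neq0 //|].
    exact: class_C_sub U'UL (class_C_comp_affine p cM oU (CF k)).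
- exact: dim_lker_linear_form lp.
move=> v Uv; rewrite memv_ker lfunE /= lphi // subr_eq0.
split; first by move=> [_ ->].
by have [Av _] := Uv; move=> /eqP.
Qed.

End ConicPseudoNorm.

Theorem proposition2p13 (R : realType) (V : vectType R) (A : set (findim V))
    (F : findim V -> R) :
  conic_domain A -> minkowski_conic_pseudo_norm A F ->
  let B := closed_unit_ball A F in
  let S := boundary_in A B in
  [/\ (* a1 *) closed_in A B /\
               (forall v, A v -> B `&` direction v !=set0),
      (* a2 *) forall v, B v -> forall l : R, 0 < l < 1 -> B (l *: v),
      (* a3 *) [/\ smooth_hypersurface S, closed_in A S &
                   forall v, S v -> transversal_at S v v]
    & (* a4 *) forall v, (B `\ 0) v ->
                 exists! l : R, 0 < l /\ S (l^-1 *: v)].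
Proof.
move=> cA nF B S; have [_ _ coneA] := cA; have [F_ge0 F0 _ _] := nF.
have SE : S = [set v | A v /\ F v = 1] by exact: boundary_unit_ballE.
split.
- split=> [|v Av]; first exact: closed_in_unit_ball.
  (* The direction of [0] is just [0], which belongs to [B]; any other ray meets [B] at
     [v / F v]. *)
  have [v0|v0] := eqVneq v 0.
    exists v; split; last by exists 1; rewrite /= ?scale1r.
    by split=> //; have [_ ->] := F0 _ Av.
  have Fv0 := pseudo_norm_gt0 nF Av v0.
  have Fi0 : 0 < (F v)^-1 by rewrite invr_gt0.
  exists ((F v)^-1 *: v); split; last by exists (F v)^-1.
  by split; [exact: coneA|rewrite (pseudo_norm_scale nF) // mulVf // gt_eqF].
- move=> v [Av Fv1] l /andP[l0 l1]; split; first exact: coneA.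
  by rewrite (pseudo_norm_scale nF) // mulr_ile1 // ?F_ge0 // ltW.
- split.
  + exact: smooth_hypersurface_unit_sphere.
  (* A closure minus an interior is closed in any topology. *)
  + rewrite /closed_in /S /boundary_in setDE; apply: closedI.
      exact: closed_closure.
    by apply: open_closedC; exact: open_interior.
  + exact: transversal_unit_sphere.
- move=> v [[Av Fv1] /eqP v0]; have Fv0 := pseudo_norm_gt0 nF Av v0.
  (* By homogeneity [F (v / l) = F v / l], which equals [1] exactly when [l = F v]. *)
  rewrite SE; exists (F v); split.
    have Fi0 : 0 < (F v)^-1 by rewrite invr_gt0.
    split=> //; split; first exact: coneA.
    by rewrite (pseudo_norm_scale nF) // mulVf // gt_eqF.
  move=> l [l0 [_]]; have li0 : 0 < l^-1 by rewrite invr_gt0.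
  rewrite (pseudo_norm_scale nF) // => /(congr1 ( *%R l)).
  by rewrite mulVKf ?mulr1 // gt_eqF.
Qed.
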